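(* Let $X$ be a Banach space, let $A,B\subset X$ be closed and convex, and let $\bar x\in A\cap B$. Then $\{A,B\}$ is subtransversal at $\bar x$ if and only if there exist numbers $\alpha\in\,]0,1[$ and $\delta>0$ such that $\|x_1^*+x_2^*\|>\alpha$ for all $a\in(A\setminus B)\cap\mathbb B_\delta(\bar x)$, $b\in(B\setminus A)\cap\mathbb B_\delta(\bar x)$, $x\in\mathbb B_\delta(\bar x)$ with $\|x-a\|=\|x-b\|$, and $x_1^*,x_2^*\in X^*$ satisfying $$\|x_1^*\|+\|x_2^*\|=1,\quad \langle x_1^*,x-a\rangle=\|x_1^*\|\,\|x-a\|,\quad \langle x_2^*,x-b\rangle=\|x_2^*\|\,\|x-b\|,$$ $$d(x_1^*,N_A(a))<\delta,\quad d(x_2^*,N_B(b))<\delta.$$ Moreover, the supremum of all such $\alpha$ (that is, of all $\alpha\in\,]0,1[$ for which this condition holds with some $\delta>0$) equals ${\rm str}[A,B](\bar x)$.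
   Context: $X^*$ is the topological dual of the (real) normed space $X$, with the dual norm, and $\langle\cdot,\cdot\rangle$ is the duality pairing. $\mathbb B_\delta(x)$ denotes the open ball with centre $x$ and radius $\delta$. $d(\cdot,S)$ is the distance to a set $S$ (in the norm of the ambient space). For a convex set $A$ and $a_0\in A$, the normal cone is $N_A(a_0):=\{x^*\in X^*\mid\langle x^*,a-a_0\rangle\le0\text{ for all }a\in A\}$. Subtransversality: for $\bar x\in A\cap B$, the pair $\{A,B\}$ is subtransversal at $\bar x$ if there exist $\alpha\in\,]0,1[$ and $\delta>0$ such that $$\alpha\, d(x,A\cap B)\le\max\{d(x,A),d(x,B)\}\quad\text{for all }x\in\mathbb B_\delta(\bar x).$$ ${\rm str}[A,B](\bar x)$ denotes the supremum of all $\alpha\in\,]0,1[$ for which this condition is satisfied for some $\delta>0$. Convention: the supremum of the empty set of numbers $\alpha$ is $0$ (in both suprema above). *)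

(* Defs.v *)
From HB Require Import structures.
From mathcomp Require Import all_boot all_order all_algebra.
From mathcomp Require Import all_classical all_reals all_analysis.

Set Implicit Arguments.
Unset Strict Implicit.
Unset Printing Implicit Defensive.

Import Order.TTheory GRing.Theory Num.Theory.
Import numFieldNormedType.Exports.

Local Open Scope classical_set_scope.
Local Open Scope ring_scope.

Section Dual.
Context (R : realType) (X : normedModType R).

Definition continuous_linear_form : {pred X -> R^o} :=
  fun f => `[< linear f /\ continuous f >].

Record dual := Dual {
  dual_fun :> X -> R^o;
  dual_funP : dual_fun \in continuous_linear_form }.

HB.instance Definition _ := [isSub for dual_fun].
HB.instance Definition _ := [Choice of dual by <:].

Lemma continuous_linear_form_submod : submod_closed continuous_linear_form.
Proof.
split=> [|a f g /asboolP[lf cf] /asboolP[lg cg]]; apply/asboolP; split.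
- by move=> a u v; rewrite [RHS]addr0 scaler0.
- exact: cst_continuous.
- move=> b u v.
  have -> : (a *: f + g) (b *: u + v) =
            a *: f (b *: u + v) + g (b *: u + v) by [].
  rewrite lf lg !scalerDr !scalerA (mulrC a b) -addrACA.
  by rewrite -scalerA -scalerDr.
- by move=> x; apply: continuousD; [apply: continuousZr; exact: cf|exact: cg].
Qed.

HB.instance Definition _ := GRing.isSubmodClosed.Build _ _
  continuous_linear_form continuous_linear_form_submod.
HB.instance Definition _ := [SubChoice_isSubLmodule of dual by <:].

Definition dual_norm (f : dual) : R :=
  sup [set `|f x| | x in [set x : X | `|x| <= 1]].

Lemma dual_linear (f : dual) : linear f.
Proof. by have /asboolP[] := dual_funP f. Qed.

Lemma dual_continuous (f : dual) : continuous f.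
Proof. by have /asboolP[] := dual_funP f. Qed.

Lemma dualZ (f : dual) (a : R) (x : X) : f (a *: x) = a *: f x.
Proof.
have l := dual_linear f.
have f0 : f 0 = 0.
  by apply: (@addIr _ (f 0)); have := l 1 0 0; rewrite !scale1r !add0r.
by have := l a x 0; rewrite f0 !addr0.
Qed.

Lemma dual_norm_has_sup (f : dual) :
  has_sup [set `|f x| | x in [set x : X | `|x| <= 1]].
Proof.
split; first by exists `|f 0|; exists 0 => //=; rewrite normr0.
pose m := GRing.isLinear.Build R X R^o *:%R f (dual_linear f).
pose F : {linear X -> R^o} := HB.pack (f : X -> R^o) m.
have /linear_bounded_continuous/bounded_funP/(_ 1)[M BM] : continuous F.
  exact: dual_continuous.
by exists M => _ [x x1 <-]; exact: BM.
Qed.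

Lemma ler_dual_norm1 (f : dual) (x : X) : `|x| <= 1 -> `|f x| <= dual_norm f.
Proof.
by move=> x1; apply: (sup_upper_bound (dual_norm_has_sup f)); exists x.
Qed.

Lemma dual_norm_le (f : dual) (M : R) :
  (forall x, `|x| <= 1 -> `|f x| <= M) -> dual_norm f <= M.
Proof.
move=> fM; apply: ge_sup; first by case: (dual_norm_has_sup f).
by move=> _ [x x1 <-]; exact: fM.
Qed.

Lemma ler_dual_normD (f g : dual) :
  dual_norm (f + g) <= dual_norm f + dual_norm g.
Proof.
apply: dual_norm_le => x x1.
by apply: (le_trans (ler_normD _ _)); rewrite lerD ?ler_dual_norm1.
Qed.

Lemma dual_normZ (a : R) (f : dual) : dual_norm (a *: f) = `|a| * dual_norm f.
Proof.
have le_normZ (b : R) (g : dual) : dual_norm (b *: g) <= `|b| * dual_norm g.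
  apply: dual_norm_le => x x1.
  by rewrite [_ x]/(b * g x) normrM ler_wpM2l// ler_dual_norm1.
have [->|a0] := eqVneq a 0.
  rewrite scale0r normr0 mul0r; apply/le_anti/andP; split.
    by apply: dual_norm_le => x _; rewrite [X in `|X|](_ : _ = 0) ?normr0.
  apply: (le_trans (normr_ge0 ((0 : dual) 0))).
  by rewrite ler_dual_norm1 ?normr0.
apply/le_anti; rewrite le_normZ/= -ler_pdivlMl ?normr_gt0//.
by rewrite -normfV -{1}[f](scalerK a0) le_normZ.
Qed.

Lemma dual_norm0_eq0 (f : dual) : dual_norm f = 0 -> f = 0.
Proof.
move=> f0; apply/val_inj/funext => x.
rewrite [RHS](_ : _ = 0)//.
have [->|x0] := eqVneq x 0.
  by rewrite -[LHS]/(f 0) -(scale0r (0 : X)) dualZ scale0r.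
have : `|f (`|x|^-1 *: x)| <= 0.
  rewrite -f0 ler_dual_norm1// normrZ normfV normr_id.
  by rewrite mulVf ?normr_eq0.
by rewrite normr_le0 dualZ scaler_eq0 invr_eq0 normr_eq0 (negPf x0) => /eqP.
Qed.

HB.instance Definition _ :=
  Lmodule_isNormed.Build R dual ler_dual_normD dual_normZ dual_norm0_eq0.

Lemma dual_normE (f : dual) :
  `|f| = sup [set `|f x| | x in [set x : X | `|x| <= 1]].
Proof. by []. Qed.

End Dual.

Section Transversality.
Context (R : realType) (X : normedModType R).
Implicit Types (A B : set X) (xbar : X) (alpha delta : R).

Definition normal_cone A (a0 : X) : set (dual X) :=
  [set f | forall a, A a -> f (a - a0) <= 0].

Definition subtransversal_with A B xbar alpha delta :=
  forall x, ball xbar delta x ->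
    (alpha%:E * edist_inf (A `&` B) x <=
       Order.max (edist_inf A x) (edist_inf B x))%E.

Definition subtransversal A B xbar :=
  exists alpha delta, [/\ 0 < alpha < 1, 0 < delta &
    subtransversal_with A B xbar alpha delta].

(* [sup set0 = 0] in the library, so this is [0] without subtransversality. *)
Definition str A B xbar : R :=
  sup [set alpha | 0 < alpha < 1 /\
    exists2 delta, 0 < delta & subtransversal_with A B xbar alpha delta].

Definition dual_subtransversal_with A B xbar alpha delta :=
  forall (a b x : X) (x1 x2 : dual X),
    (A `\` B) a -> ball xbar delta a ->
    (B `\` A) b -> ball xbar delta b ->
    ball xbar delta x -> `|x - a| = `|x - b| ->
    `|x1| + `|x2| = 1 ->
    x1 (x - a) = `|x1| * `|x - a| ->
    x2 (x - b) = `|x2| * `|x - b| ->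
    (edist_inf (normal_cone A a) x1 < delta%:E)%E ->
    (edist_inf (normal_cone B b) x2 < delta%:E)%E ->
    `|x1 + x2| > alpha.

End Transversality.

(* Main.v *)
Require Import Defs.
From HB Require Import structures.
From mathcomp Require Import all_boot all_order all_algebra.
From mathcomp Require Import all_classical all_reals all_analysis.
From mathcomp Require Import ring lra.

Set Implicit Arguments.
Unset Strict Implicit.
Unset Printing Implicit Defensive.

Import Order.TTheory GRing.Theory Num.Theory.
Import numFieldNormedType.Exports.

Local Open Scope classical_set_scope.
Local Open Scope ring_scope.

(** The two conditions are compared through the same quantity: the larger of
    the distances from a point x to points a of A and b of B, against the
    distance from x to the intersection.

    From the metric condition to the dual one ([subtransversal_dual]): with
    [r = |x - a| = |x - b|], subtransversality gives a common point w with
    [alpha * |x - w|] barely above r. Both functionals are nearly normal, so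
    they are almost nonpositive on [w - a] and [w - b]; as they attain their
    norms on [x - a] and [x - b], adding up yields
    [r <= |x1 + x2| * |x - w| + small], that is [|x1 + x2| >= alpha - small].
    The loss can be made arbitrarily small but not zero, hence a slightly
    smaller constant.

    From the dual condition to the metric one ([dual_subtransversal]), with the
    same constant: if the metric inequality fails at some x0, then Ekeland's
    variational principle ([ekeland]), applied on A x B x X to
    [max(|x - u|, |x - v|)] with a metric weighing the three variables
    differently, yields a point where this function plus the distance to that
    point is minimal. Neither of its first two coordinates is
    common to A and B, as it would then be closer to x0 than any common point
    can be. Convex duality at the minimum ([max_dist_multipliers])
    produces two functionals that violate the dual condition.

    Convex duality is derived from the theorem of Mazur and Orlicz
    ([mazur_orlicz]), a form of the Hahn-Banach theorem that fits the
    situation: it gives a linear minorant of a sublinear functional compatible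
    with a whole convex cone of inequalities. Its proof uses that a minimal
    sublinear functional is linear, so that Zorn's lemma is applied to
    functionals on the whole space and no linear subspaces occur.

    Finally, the set of dual constants is contained in the set of primal ones
    and contains every positive number below a primal one, so both have the same
    supremum, the value 0 of empty suprema included. *)

(** * Sublinear functionals and the theorem of Mazur and Orlicz *)

Section Sublinear.
Context (R : realType) (E : lmodType R).
Implicit Types (p q l : E -> R) (D : set (E * R)).

Definition sublinear p :=
  (forall x y, p (x + y) <= p x + p y) /\
  (forall s x, 0 <= s -> p (s *: x) = s * p x).

Lemma sublinear0 p : sublinear p -> p 0 = 0.
Proof. by case=> _ /(_ 0 0 (lexx _)); rewrite scale0r mul0r. Qed.

Definition convex_cone D :=
  [/\ D (0, 0), forall d e, D d -> D e -> D (d.1 + e.1, d.2 + e.2) &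
      forall s d, 0 <= s -> D d -> D (s *: d.1, s * d.2)].

(** The infimal convolution of [p] with the inequalities listed in
    [D]: a pair [(z, t)] of [D] stands for the requirement [0 <= l z + t] on a
    linear functional [l]. *)
Definition cone_infimum p D (y : E) : R := inf [set p (y + d.1) + d.2 | d in D].

(** Subadditivity gives [- p (- y)] as a lower bound of the values whose infimum
    is taken; it is the cone structure of [D] that makes the infimum sublinear.
    The last conclusion turns the inequalities of [D] into bounds that every
    linear functional below the infimum inherits. *)
Lemma sublinear_cone_infimum p D : sublinear p -> convex_cone D ->
    (forall d, D d -> 0 <= p d.1 + d.2) ->
  [/\ sublinear (cone_infimum p D), forall y, cone_infimum p D y <= p y &
      forall d, D d -> cone_infimum p D (- d.1) <= d.2].
Proof.
move=> sp [D0 DD DZ] pD_ge0; have [pD pZ] := sp.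
pose V y := [set p (y + d.1) + d.2 | d in D].
have Vlb y d : D d -> - p (- y) <= p (y + d.1) + d.2.
  move=> Dd; have := pD (y + d.1) (- y); have := pD_ge0 _ Dd.
  rewrite addrAC subrr add0r; lra.
have Vinf y : has_inf (V y).
  split; first by exists (p (y + 0) + 0), (0, 0).
  by exists (- p (- y)) => _ [d Dd <-]; exact: Vlb.
have lb_inf y d : D d -> cone_infimum p D y <= p (y + d.1) + d.2.
  by move=> Dd; apply: ge_inf; [have [] := Vinf y | exists d].
have glb_inf y m : (forall d, D d -> m <= p (y + d.1) + d.2) ->
    m <= cone_infimum p D y.
  move=> h; apply: lb_le_inf; first by have [] := Vinf y.
  by move=> _ [d Dd <-]; exact: h.
have leZ s y : 0 < s -> cone_infimum p D (s *: y) <= s * cone_infimum p D y.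
  move=> s0; rewrite -ler_pdivrMl//; apply: (glb_inf) => d Dd.
  rewrite ler_pdivrMl// mulrDr -pZ ?(ltW s0)// scalerDr.
  exact: (lb_inf _ (s *: d.1, s * d.2) (DZ _ _ (ltW s0) Dd)).
split.
- split=> [x y|s x s0].
    rewrite -lerBlDr; apply: (glb_inf) => d Dd; rewrite lerBlDr -lerBlDl.
    apply: (glb_inf) => e De; rewrite lerBlDl.
    apply: le_trans (lb_inf _ _ (DD _ _ Dd De)) _ => /=.
    have := pD (x + d.1) (y + e.1); rewrite (addrACA x); lra.
  have inf0 : cone_infimum p D 0 = 0.
    apply/le_anti/andP; split.
      by have := lb_inf 0 _ D0; rewrite /= !addr0 (sublinear0 sp).
    by apply: (glb_inf) => d Dd; rewrite add0r pD_ge0.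
  have [->|sN0] := eqVneq s 0; first by rewrite scale0r mul0r.
  have {s0} sN0 : 0 < s by rewrite lt0r sN0.
  apply/le_anti; rewrite leZ//= -ler_pdivlMl// -{1}[x](scalerK (lt0r_neq0 sN0)).
  by rewrite leZ ?invr_gt0.
- by move=> y; have := lb_inf y _ D0; rewrite /= !addr0.
- move=> d Dd; have := lb_inf (- d.1) _ Dd.
  by rewrite addNr (sublinear0 sp) add0r.
Qed.

(** In a chain, two functionals may be replaced by the smaller one, so the
    pointwise infimum is again subadditive; it is finite because every
    sublinear functional below [p] is bounded below by [- p (- x)]. *)
Lemma exists_minimal_sublinear p : sublinear p ->
  exists l, [/\ sublinear l, forall x, l x <= p x &
    forall q, sublinear q -> (forall x, q x <= l x) -> q = l].
Proof.
move=> sp; pose T := {q : E -> R | sublinear q /\ forall x, q x <= p x}.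
pose below (s t : T) := `[< forall x, sval t x <= sval s x >].
have [||||[l [sl lp]] lmin] := @Zorn T below.
- by move=> t; apply/asboolP.
- move=> r s t /asboolP rs /asboolP st; apply/asboolP => x.
  exact: le_trans (st x) (rs x).
- move=> [s hs] [t ht] /asboolP st /asboolP ts; apply: eq_exist.
  apply/funext => x.
  by apply/le_anti/andP; split; [exact: ts|exact: st].
- move=> A totA; have [[a0 Aa0]|A0] := pselect (A !=set0); last first.
    by exists (exist _ p (conj sp (fun=> lexx _))) => s As; case: A0; exists s.
  pose V x := [set sval a x | a in A].
  have Vlb x a : A a -> - p (- x) <= sval a x.
    move=> _; case: a => a [sa ap] /=; have := ap (- x).
    have := (proj1 sa) x (- x); rewrite subrr sublinear0//; lra.
  have Vinf x : has_inf (V x).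
    split; first by exists (sval a0 x), a0.
    by exists (- p (- x)) => _ [a Aa <-]; exact: Vlb.
  pose m x := inf (V x).
  have m_le x a : A a -> m x <= sval a x.
    by move=> Aa; apply: ge_inf; [have [] := Vinf x | exists a].
  have le_m x c : (forall a, A a -> c <= sval a x) -> c <= m x.
    move=> h; apply: lb_le_inf; first by have [] := Vinf x.
    by move=> _ [a Aa <-]; exact: h.
  have sm : sublinear m.
    split=> [x y|s x s0].
      rewrite -lerBlDr; apply: (le_m) => a Aa; rewrite lerBlDr -lerBlDl.
      apply: (le_m) => b Ab; rewrite lerBlDl.
      have [c [Ac ca cb]] :
          exists c, [/\ A c, sval c x <= sval a x & sval c y <= sval b y].
        have [/asboolP ab|/asboolP ba] := totA _ _ Aa Ab; first by exists b.
        by exists a.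
      apply: le_trans (m_le _ _ Ac) _; apply: le_trans (lerD ca cb).
      by case: (svalP c) => -[cD _] _.
    have mZ_le : m (s *: x) <= s * m x.
      have [->|sN0] := eqVneq s 0.
        rewrite scale0r mul0r; have := m_le 0 _ Aa0.
        by case: (svalP a0) => /sublinear0 ->.
      have {}s0 : 0 < s by rewrite lt0r sN0.
      rewrite -ler_pdivrMl//; apply: (le_m) => a Aa; rewrite ler_pdivrMl//.
      have [[_ aZ] _] := svalP a; rewrite -aZ ?(ltW s0)//; exact: (m_le).
    apply/le_anti; rewrite mZ_le/=; apply: (le_m) => a Aa.
    have [[_ aZ] _] := svalP a; rewrite aZ//.
    apply: ler_wpM2l => //; exact: (m_le).
  have mp x : m x <= p x by apply: le_trans (m_le _ _ Aa0) _; case: (svalP a0).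
  exists (exist _ m (conj sm mp)) => s As; apply/asboolP => x /=; exact: (m_le).
exists l; split=> // q sq ql.
have qp x : q x <= p x by apply: le_trans (ql x) (lp x).
have := lmin (exist _ q (conj sq qp)); rewrite /below /= => /(_ (asboolT ql)).
by case.
Qed.

(** A minimal sublinear functional [l] below [cone_infimum p D] is linear:
    lowering it along the ray of multiples of [(y, - l y)] keeps it sublinear,
    and minimality then says [l (- y) <= - l y]. *)
Theorem mazur_orlicz p D : sublinear p -> convex_cone D ->
    (forall d, D d -> 0 <= p d.1 + d.2) ->
  exists l : E -> R^o, [/\ linear l, forall x, l x <= p x &
    forall d, D d -> 0 <= l d.1 + d.2].
Proof.
move=> sp cD pD_ge0.
have [sq qp qD] := sublinear_cone_infimum sp cD pD_ge0.
have [l [sl lq lmin]] := exists_minimal_sublinear sq.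
have [lD lZ] := sl.
have lN y : l (- y) = - l y.
  pose ray : set (E * R) :=
    [set d | exists2 s, 0 <= s & d = (s *: y, - (s * l y))].
  have ray_cone : convex_cone ray.
    split=> [|_ _ [s s0 ->] [t t0 ->]|s _ s0 [t t0 ->]] /=.
    - by exists 0; rewrite // scale0r mul0r oppr0.
    - by exists (s + t); rewrite ?addr_ge0// scalerDl mulrDl opprD.
    - by exists (s * t); rewrite ?mulr_ge0// scalerA mulrN mulrA.
  have [|sr rl rray] := sublinear_cone_infimum sl ray_cone.
    by move=> _ [s s0 ->] /=; rewrite lZ// subrr.
  have /rray : ray (y, - l y) by exists 1; rewrite ?scale1r ?mul1r.
  have := lD y (- y); rewrite subrr (sublinear0 sl) (lmin _ sr rl) /=.
  lra.
have lD_eq x y : l (x + y) = l x + l y.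
  apply/le_anti; rewrite lD /=; have := lD (- x) (- y).
  rewrite -opprD !lN; lra.
exists l; split=> [s x y|x|d Dd].
- rewrite lD_eq; congr (_ + _); have [s0|s0] := leP 0 s; first exact: lZ.
  by rewrite -[LHS]opprK -lN -scaleNr lZ ?oppr_ge0 ?(ltW s0)// mulNr opprK.
- exact: le_trans (lq x) (qp x).
- have := qD _ Dd; have := lq (- d.1); rewrite lN; lra.
Qed.
End Sublinear.

(** * Duality for norms *)

Section DualTheory.
Context (R : realType).

Lemma convex_setP (V : lmodType R) (K : set V) : convex_set K <->
  forall x y (s : R), K x -> K y -> 0 <= s <= 1 -> K (s *: x + (1 - s) *: y).
Proof.
split=> [cK x y s Kx Ky /andP[s0 s1]|cK x y s].
  by have := cK x y (Itv01 s0 s1); rewrite !inE; apply.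
by rewrite !inE => Kx Ky; apply: cK => //; rewrite ge0 le1.
Qed.

Lemma dualD (V : normedModType R) (f : dual V) x y : f (x + y) = f x + f y.
Proof. by have := dual_linear f 1 x y; rewrite !scale1r. Qed.

Lemma dualN (V : normedModType R) (f : dual V) x : f (- x) = - f x.
Proof. by rewrite -scaleN1r dualZ scaleN1r. Qed.

Lemma dualB (V : normedModType R) (f : dual V) x y : f (x - y) = f x - f y.
Proof. by rewrite dualD dualN. Qed.

Lemma ler_dual_norm (V : normedModType R) (f : dual V) x :
  `|f x| <= `|f| * `|x|.
Proof.
have [->|x0] := eqVneq x 0.
  by have := dualB f 0 0; rewrite !subrr => ->; rewrite !normr0 mulr0.
have := @ler_dual_norm1 _ _ f (`|x|^-1 *: x).
rewrite dualZ !normrZ normfV normr_id mulVf ?normr_eq0// => /(_ (lexx _)).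
by rewrite ler_pdivrMl ?normr_gt0// mulrC.
Qed.

Lemma dual_le_norm (V : normedModType R) (f : dual V) x : f x <= `|f| * `|x|.
Proof. exact: le_trans (ler_norm _) (ler_dual_norm f x). Qed.

Lemma dual_of_linear (V : normedModType R) (l : V -> R^o) c : 0 <= c ->
    linear l -> (forall x, l x <= c * `|x|) ->
  exists2 f : dual V, `|f| <= c & f =1 l.
Proof.
move=> c0 ll lc.
pose m := GRing.isLinear.Build R V R^o *:%R l ll.
pose F : {linear V -> R^o} := HB.pack (l : V -> R^o) m.
have l_abs x : `|l x| <= c * `|x|.
  rewrite ler_norml lc andbT lerNl.
  by have := lc (- x); rewrite -[l (- x)]/(F (- x)) raddfN normrN.
have cl : continuous (F : V -> R^o).
  apply/linear_bounded_continuous/bounded_funP => r; exists (c * r) => x xr.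
  by apply: le_trans (l_abs x) _; rewrite ler_wpM2l.
have lP : (l : V -> R^o) \in @continuous_linear_form R V by apply/asboolP.
exists (Dual lP) => //; apply: dual_norm_le => x x1.
by apply: le_trans (l_abs x) _; rewrite ler_piMr.
Qed.

(** [K] plays the role of the epigraph of a convex function [phi], and the
    hypothesis says [c * |z| + phi z >= 0]; the conclusion replaces the norm by
    a functional of norm at most [c]. The theorem of Mazur and Orlicz applies
    to the cone generated by [K]. *)
Lemma norm_convex_minorant (V : normedModType R) (c : R) (K : set (V * R^o)) :
    0 <= c -> convex_set K -> K !=set0 ->
    (forall k, K k -> 0 <= c * `|k.1| + k.2) ->
  exists2 f : dual V, `|f| <= c & forall k, K k -> 0 <= f k.1 + k.2.
Proof.
move=> c0 /convex_setP cK [k0 Kk0] Kge0.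
pose p (x : V) := c * `|x|.
have sp : sublinear p.
  split=> [x y|s x s0]; rewrite /p.
    by rewrite -mulrDr ler_wpM2l ?ler_normD.
  by rewrite normrZ ger0_norm// mulrCA.
pose D : set (V * R) :=
  [set d | exists s k, [/\ 0 <= s, K k & d = (s *: k.1, s * k.2)]].
have DK k : K k -> D k.
  by move=> Kk; exists 1, k; split => //; rewrite scale1r mul1r; case: (k).
have cD : convex_cone D.
  split.
  - by exists 0, k0; rewrite scale0r mul0r.
  - move=> _ _ [s [k [s0 Kk ->]]] [t [h [t0 Kh ->]]] /=.
    have [st0|st0] := eqVneq (s + t) 0.
      have [-> ->] : s = 0 /\ t = 0 by split; lra.
      by exists 0, k0; rewrite !scale0r !mul0r !addr0.
    have u0 : 0 < s + t by rewrite lt0r st0 addr_ge0.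
    (* the sum of two multiples is a multiple of a convex combination *)
    exists (s + t), (s / (s + t) *: k + (1 - s / (s + t)) *: h); split=> //.
    + exact: ltW.
    + apply: cK => //; rewrite divr_ge0 ?addr_ge0//=.
      by rewrite ler_pdivrMr// mul1r lerDl.
    + have e1 : (s + t) * (s / (s + t)) = s by field.
      have e2 : (s + t) * (1 - s / (s + t)) = t by field.
      congr pair => /=.
        by rewrite scalerDr !scalerA e1 e2.
      rewrite -[RHS]/((s + t) * (s / (s + t) * k.2 + (1 - s / (s + t)) * h.2)).
      by rewrite mulrDr (mulrA (s + t)) e1 (mulrA (s + t)) e2.
  - move=> s _ s0 [t [k [t0 Kk ->]]] /=; exists (s * t), k.
    by rewrite mulr_ge0// scalerA mulrA.
have pD d : D d -> 0 <= p d.1 + d.2.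
  move=> [s [k [s0 Kk ->]]] /=; case: sp => _ ->//.
  by rewrite -mulrDr mulr_ge0// Kge0.
have [l [ll lp lD]] := mazur_orlicz sp cD pD.
have [f fc fl] := dual_of_linear c0 ll lp.
by exists f => // k Kk; rewrite fl; exact: lD (DK _ Kk).
Qed.

(** The norm of a product is the maximum of the norms, so its dual norm is the
    sum; only the inequality that yields [|f1| + |f2| <= 1] for the
    multipliers is stated. It follows by choosing the signs of unit vectors
    of both factors independently. *)
Lemma dual_prod (X Y : normedModType R) (f : dual (X * Y)%type) :
  exists (f1 : dual X) (f2 : dual Y), `|f1| + `|f2| <= `|f| /\
    forall x y, f (x, y) = f1 x + f2 y.
Proof.
have fnorm x y : f (x, y) <= `|f| * Num.max `|x| `|y|.
  by have := dual_le_norm f (x, y); rewrite prod_normE.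
have [|x|f1 _ f1E] := @dual_of_linear X (fun x => f (x, 0)) `|f| (normr_ge0 _).
- move=> s x y; rewrite -dual_linear; congr (f _).
  by congr pair; rewrite /= scaler0 addr0.
- by have := fnorm x 0; rewrite normr0 max_l.
have [|y|f2 _ f2E] := @dual_of_linear Y (fun y => f (0, y)) `|f| (normr_ge0 _).
- move=> s x y; rewrite -dual_linear; congr (f _).
  by congr pair; rewrite /= scaler0 addr0.
- by have := fnorm 0 y; rewrite normr0 max_r.
have fE x y : f (x, y) = f1 x + f2 y.
  rewrite f1E f2E -dualD; congr (f _).
  by congr pair; rewrite /= ?addr0 ?add0r.
exists f1, f2; split=> //.
have signed (V : normedModType R) (g : dual V) x :
    exists2 x', `|x'| = `|x| & g x' = `|g x|.
  have [gx|gx] := leP 0 (g x); first by exists x => //; rewrite ger0_norm.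
  by exists (- x); rewrite ?normrN// dualN ltr0_norm.
rewrite -lerBrDr; apply: dual_norm_le => x x1.
rewrite lerBrDl -lerBrDr; apply: dual_norm_le => y y1; rewrite lerBrDr.
have [x' xx' <-] := signed _ f1 x; have [y' yy' <-] := signed _ f2 y.
rewrite addrC -fE; apply: le_trans (fnorm _ _) _.
by rewrite ler_piMr// ge_max xx' yy' x1.
Qed.

End DualTheory.

(** * Ekeland's variational principle *)

(** The distance [D] is an arbitrary quasi-metric on a bare type, because the
    application weighs the factors of a product differently. Completeness and
    semicontinuity are stated for [D] in epsilon form so that no topology has
    to be built from it. *)
Section Ekeland.
Context (R : realType) (T : Type) (S : set T) (D : T -> T -> R) (f : T -> R).
Hypothesis D_ge0 : forall x y, 0 <= D x y.
Hypothesis Dxx : forall x, D x x = 0.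
Hypothesis D_triangle : forall x y z, D x z <= D x y + D y z.
Hypothesis D_complete : forall y : nat -> T, (forall n, S (y n)) ->
  (forall e, 0 < e -> exists N, forall n, (N <= n)%N -> D (y N) (y n) <= e) ->
  exists2 z, S z &
    forall e, 0 < e -> exists N, forall n, (N <= n)%N -> D (y n) z <= e.
Hypothesis f_lsc : forall z e, S z -> 0 < e ->
  exists2 h, 0 < h & forall y, S y -> D y z <= h -> f z <= f y + e.
Hypothesis f_ge0 : forall z, S z -> 0 <= f z.

Let below x y := S y /\ f y + D x y <= f x.

Let below_trans x y z : below x y -> below y z -> below x z.
Proof. by move=> [_ xy] [Sz yz]; split=> //; have := D_triangle x y z; lra. Qed.

Let below_refl x : S x -> below x x.
Proof. by move=> Sx; split=> //; rewrite Dxx addr0. Qed.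

Let almost_lowest x e : S x -> 0 < e ->
  exists2 y, below x y & forall z, below x z -> f y <= f z + e.
Proof.
move=> Sx e0; pose V := [set f z | z in below x].
have Vinf : has_inf V.
  split; first by exists (f x), x => //; exact: below_refl.
  by exists 0 => _ [z [/f_ge0 ? _] <-].
have [_ [y xy <-] yV] := inf_adherent e0 Vinf.
exists y => // z xz; apply/ltW/(lt_le_trans yV); rewrite lerD2r.
by apply: ge_inf; [case: Vinf | exists z].
Qed.

(** Each step moves to an almost lowest point of the part of [S] that [below]
    still permits. Distances along the sequence are bounded by decreases of
    [f], which is bounded below, so the sequence is Cauchy; its limit is below
    every term, and anything strictly below the limit would have a value
    smaller than the infima the sequence approximates. *)
Theorem ekeland z0 : S z0 ->
  exists z, [/\ S z, f z + D z0 z <= f z0 &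
    forall y, S y -> f z <= f y + D z y].
Proof.
move=> Sz0; pose e (n : nat) : R := n.+1%:R^-1.
have e_gt0 n : 0 < e n by rewrite invr_gt0.
have /choice[next nextP] (nx : nat * T) : exists y, S nx.2 ->
    below nx.2 y /\ forall z, below nx.2 z -> f y <= f z + e nx.1.
  case: nx => n x /=.
  have [Sx|nSx] := pselect (S x); last by exists x.
  by have [y ? ?] := almost_lowest Sx (e_gt0 n); exists y.
pose y := fix y n := if n is m.+1 then next (m, y m) else z0.
have Sy n : S (y n) by elim: n => //= n /(nextP (n, _))[[]].
have yS n : below (y n) (y n.+1) by have [] := nextP (n, y n) (Sy n).
have y_mono m n : (m <= n)%N -> below (y m) (y n).
  move=> /subnKC <-; elim: (n - m)%N => [|k ih].
    by rewrite addn0; exact: below_refl.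
  by rewrite addnS; exact: below_trans ih (yS _).
have y_cauchy r : 0 < r -> exists N, forall n, (N <= n)%N -> D (y N) (y n) <= r.
  move=> r0; pose V := [set f (y n) | n in [set: nat]].
  have Vinf : has_inf V.
    split; first by exists (f (y 0%N)), 0%N.
    by exists 0 => _ [n _ <-]; exact: f_ge0.
  have [_ [N _ <-] NV] := inf_adherent r0 Vinf; exists N => n Nn.
  have [_ ] := y_mono _ _ Nn.
  have : inf V <= f (y n) by apply: ge_inf; [case: Vinf | exists n].
  lra.
have [z Sz yz] := D_complete Sy y_cauchy.
have y_below n : below (y n) z.
  split=> //; apply/ler_addgt0Pr => r r0; have r20 : 0 < r / 2 by lra.
  have [h h0 fz] := f_lsc Sz r20.
  have [|N Nz] := yz (Num.min h (r / 2)); first by rewrite lt_min h0.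
  have := Nz (maxn N n) (leq_maxl _ _); rewrite le_min => /andP[zh zr].
  have := fz _ (Sy _) zh; have [_] := y_mono _ _ (leq_maxr N n).
  have := D_triangle (y n) (y (maxn N n)) z; lra.
exists z; split=> // [|x Sx]; first by have [] := y_below 0%N.
rewrite leNgt; apply/negP => xz.
have zx : below z x by split=> //; exact: ltW.
have fzx : f z <= f x.
  apply/ler_addgt0Pr => r r0; pose n := Num.truncn r^-1.
  have en : e n <= r.
    rewrite /e -[leRHS]invrK lef_pV2 ?posrE ?invr_gt0 ?ltr0n//.
    exact/ltW/truncnS_gt.
  have [_ /(_ x (below_trans (y_below n) zx))/=] := nextP (n, y n) (Sy n).
  have [_] := y_below n.+1; rewrite /=; have := D_ge0 (y n.+1) z => /=; lra.
have := D_ge0 z x; lra.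
Qed.
End Ekeland.

(** * Distances and limits in normed spaces *)

Section Distance.
Context (R : realType) (V : normedModType R).
Implicit Types (A : set V) (x a : V) (r : R).

Lemma edist_normE x a : edist (x, a) = `|x - a|%:E.
Proof.
apply/le_anti/andP; split.
  apply/lee_addgt0Pr => e e0; rewrite -EFinD; apply: edist_fin.
    by rewrite ltr_wpDl.
  by rewrite -ball_normE /ball_/= ltrDl.
apply: le_ereal_inf_tmp => _ [r [r0 xr] <-].
by move: xr; rewrite -ball_normE /ball_/= lee_fin => /ltW.
Qed.

Lemma edist_inf_ltP A x r :
  (edist_inf A x < r%:E)%E <-> exists2 a, A a & `|x - a| < r.
Proof.
split=> [/ereal_inf_lt[_ [a Aa <-]]|[a Aa xa]].
  by rewrite edist_normE lte_fin; exists a.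
apply: (@le_lt_trans _ _ `|x - a|%:E) => //; apply: ereal_inf_lbound.
by exists a; rewrite // edist_normE.
Qed.

End Distance.

(** Distances to sets are infima that need not be attained; naming strict upper
    bounds of them removes the extended reals from all later arguments. *)
Lemma subtransversal_withP (R : realType) (X : normedModType R) (A B : set X)
    (xbar : X) (alpha delta : R) : A `&` B !=set0 -> 0 < alpha ->
  subtransversal_with A B xbar alpha delta <->
  forall x a b r, ball xbar delta x -> A a -> B b -> `|x - a| < r ->
    `|x - b| < r -> exists2 w, (A `&` B) w & alpha * `|x - w| < r.
Proof.
move=> [w0 ABw0] alpha0; split=> [st x a b r xd Aa Bb xa xb|st x xd].
  have : (alpha%:E * edist_inf (A `&` B) x < r%:E)%E.
    apply: le_lt_trans (st x xd) _; rewrite gt_max; apply/andP; split.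
      by apply/edist_inf_ltP; exists a.
    by apply/edist_inf_ltP; exists b.
  rewrite muleC -lte_pdivlMr// => /edist_inf_ltP[w ABw xw].
  by exists w; rewrite // -ltr_pdivlMl// mulrC.
have dfin : edist_inf (A `&` B) x \is a fin_num.
  rewrite ge0_fin_numE ?edist_inf_ge0//.
  apply: (@lt_trans _ _ (`|x - w0| + 1)%:E); last exact: ltry.
  by apply/edist_inf_ltP; exists w0; rewrite // ltrDl.
rewrite leNgt; apply/negP; rewrite -(fineK dfin) -EFinM gt_max.
move=> /andP[/edist_inf_ltP[a Aa xa] /edist_inf_ltP[b Bb xb]].
have [w ABw] := st x a b _ xd Aa Bb xa xb.
rewrite ltr_pM2l// -lte_fin fineK// ltNge => /negP; apply.
by apply: ereal_inf_lbound; exists w; rewrite // edist_normE.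
Qed.

Lemma cauchy_seq_closed_limit (R : realType) (X : completeNormedModType R)
    (C : set X) (y : nat -> X) : closed C -> (forall n, C (y n)) ->
  (forall e, 0 < e -> exists N, forall n, (N <= n)%N -> `|y N - y n| <= e) ->
  exists2 z, C z &
    forall e, 0 < e -> exists N, forall n, (N <= n)%N -> `|y n - z| <= e.
Proof.
move=> clC Cy y_cauchy.
have cy : cvg (y @ \oo).
  apply/cauchy_cvgP/cauchy_exP => e e0.
  have [|N yN] := y_cauchy (e / 2); first by lra.
  exists (y N); exists N => // n /= /yN; rewrite -ball_normE /ball_/=; lra.
exists (lim (y @ \oo)); first by apply: closed_cvg cy => //; exact: nearW.
move=> e e0; have /cvgrPdist_le/(_ _ e0)[N _ yN] := cy.
by exists N => n Nn; rewrite distrC; exact: yN.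
Qed.

(** * Normal cones and multipliers *)

Section Cones.
Context (R : realType) (X : normedModType R).
Implicit Types (A B C : set X) (f : dual X).

(** The hypothesis says that [u |-> eps * |u - c| - f (u - c)] is minimal over
    [C] at [c]; [norm_convex_minorant] replaces its first term by a functional
    [g] of norm at most [eps], and [f - g] is then normal. *)
Lemma approximate_normal_near_cone C (c : X) f (eps : R) :
    convex_set C -> C c -> 0 <= eps ->
    (forall u, C u -> f (u - c) <= eps * `|u - c|) ->
  exists2 n, normal_cone C c n & `|f - n| <= eps.
Proof.
move=> /convex_setP cC Cc eps0 f_le.
pose K : set (X * R^o) := [set (u - c, - f (u - c)) | u in C].
have [||k [u Cu <-]/=|g ge gK] := @norm_convex_minorant _ _ eps K eps0.
- apply/convex_setP => _ _ s [u Cu <-] [v Cv <-] s01.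
  exists (s *: u + (1 - s) *: v); first exact: cC.
  have e : s *: u + (1 - s) *: v - c = s *: (u - c) + (1 - s) *: (v - c).
    rewrite !scalerBr addrACA -opprD -scalerDl.
    by rewrite [s + _]addrC subrK scale1r.
  apply: injective_projections => /=; rewrite e//.
  by rewrite (dualD f (s *: _)) !dualZ !scalerN opprD.
- by exists (c - c, - f (c - c)), c.
- by have := f_le u Cu; lra.
- exists (f - g).
    move=> u Cu; rewrite -[leLHS]/(f (u - c) - g (u - c)).
    by have := gK _ (imageP _ Cu) => /=; lra.
  by rewrite subKr.
Qed.

(** The necessary conditions at a minimum of the perturbed function. The norm of
    X x X at [(z - u, z - v)] is [max(|z - u|, |z - v|)], so
    [norm_convex_minorant] linearizes exactly this term and gives a pair
    [(f, g)] with [|f| + |g| <= 1]. At the minimum the linearization is at least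
    the maximum itself, which forces equality everywhere: the norms add up to 1,
    both functionals attain their norms, and a functional belonging to a
    distance smaller than the maximum vanishes. The last case is
    excluded since the other functional would have norm 1 whereas
    [|f + g| <= alpha < 1]; therefore the two distances agree. Varying z, u or v
    alone gives the bound on [f + g] and the approximate normality. *)
Lemma max_dist_multipliers A B (a b x : X) (alpha eps : R) :
    convex_set A -> convex_set B -> A a -> B b -> 0 <= alpha < 1 -> 0 <= eps ->
    0 < Num.max `|x - a| `|x - b| ->
    (forall u v z, A u -> B v -> Num.max `|x - a| `|x - b| <=
       Num.max `|z - u| `|z - v| +
       (alpha * `|x - z| + eps * (`|a - u| + `|b - v|))) ->
  `|x - a| = `|x - b| /\
  exists f g : dual X, [/\ `|f| + `|g| = 1, f (x - a) = `|f| * `|x - a|,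
    g (x - b) = `|g| * `|x - b|, `|f + g| <= alpha &
    (exists2 n, normal_cone A a n & `|f - n| <= eps) /\
    (exists2 n, normal_cone B b n & `|g - n| <= eps)].
Proof.
move=> cvA cvB Aa Bb /andP[alpha0 alpha1] eps0; set r := Num.max _ _ => r0 rmin.
pose G u v z := alpha * `|x - z| + eps * (`|a - u| + `|b - v|).
pose K : set ((X * X) * R^o) := [set k | exists u v z,
  [/\ A u, B v, k.1 = (z - u, z - v) & G u v z - r <= k.2]].
have rG u v z : A u -> B v -> r <= Num.max `|z - u| `|z - v| + G u v z.
  exact: rmin.
have norm_conv (s : R) (p y z : X) : 0 <= s <= 1 ->
    `|p - (s *: y + (1 - s) *: z)| <= s * `|p - y| + (1 - s) * `|p - z|.
  move=> /andP[s0 s1].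
  have -> : p - (s *: y + (1 - s) *: z) = s *: (p - y) + (1 - s) *: (p - z).
    rewrite !scalerBr addrACA -opprD -scalerDl.
    by rewrite [s + _]addrC subrK scale1r.
  by apply: le_trans (ler_normD _ _) _; rewrite !normrZ !ger0_norm// subr_ge0.
have cK : convex_set K.
  apply/convex_setP => k h s [u [v [z [Au Bv kE Gk]]]].
  move=> [u' [v' [z' [Au' Bv' hE Gh]]]] s01.
  exists (s *: u + (1 - s) *: u'), (s *: v + (1 - s) *: v').
  exists (s *: z + (1 - s) *: z').
  have diff (p p' q q' : X) :
      s *: p + (1 - s) *: p' - (s *: q + (1 - s) *: q') =
      s *: (p - q) + (1 - s) *: (p' - q') by rewrite !scalerBr opprD addrACA.
  split.
  - exact: (proj1 (convex_setP _) cvA).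
  - exact: (proj1 (convex_setP _) cvB).
  - by rewrite /= kE hE !diff.
  - rewrite (_ : (_ + _).2 = (s * k.2 + (1 - s) * h.2 : R))//.
    have [s0 s1] := andP s01; have s1' : 0 <= 1 - s by rewrite subr_ge0.
    have := ler_wpM2l s0 Gk; have := ler_wpM2l s1' Gh.
    have := ler_wpM2l alpha0 (norm_conv s x z z' s01).
    have := ler_wpM2l eps0 (norm_conv s a u u' s01).
    have := ler_wpM2l eps0 (norm_conv s b v v' s01).
    rewrite /G; lra.
have K0 : K ((x - a, x - b), - r).
  by exists a, b, x; rewrite /G !subrr normr0 !mulr0 addr0 mulr0 addr0 add0r.
have [k [u [v [z [Au Bv kE Gk]]]]|F F1 FK] :=
    norm_convex_minorant ler01 cK (ex_intro _ _ K0).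
  by rewrite mul1r kE prod_normE /=; have := rG u v z Au Bv; lra.
have [f [g [fg1 FE]]] := dual_prod F.
have key u v z : A u -> B v -> r <= f (z - u) + g (z - v) + G u v z.
  move=> Au Bv; have : K ((z - u, z - v), G u v z - r) by exists u, v, z.
  by move=> /FK; rewrite FE/=; lra.
have Fr : r <= f (x - a) + g (x - b).
  have := key a b x Aa Bb.
  by rewrite /G !subrr normr0 !mulr0 addr0 mulr0 !addr0.
have fle := dual_le_norm f (x - a); have gle := dual_le_norm g (x - b).
have ar : `|x - a| <= r by rewrite le_max lexx.
have br : `|x - b| <= r by rewrite le_max lexx orbT.
have far := ler_wpM2l (normr_ge0 f) ar; have gbr := ler_wpM2l (normr_ge0 g) br.
have norm1 : `|f| + `|g| = 1.
  apply/le_anti; rewrite (le_trans fg1 F1)/= -(ler_pM2r r0) mul1r mulrDl; lra.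
have sumr : `|f| * r + `|g| * r = r by rewrite -mulrDl norm1 mul1r.
have sum_le : `|f + g| <= alpha.
  have le_alpha y : - (f y + g y) <= alpha * `|y|.
    have := key a b (x + y) Aa Bb.
    rewrite /G !subrr !normr0 !addr0 mulr0 addr0 opprD addrA subrr add0r normrN.
    rewrite ![x + y - _]addrAC (dualD f) (dualD g); lra.
  apply: dual_norm_le => y y1; rewrite -[(f + g) y]/(f y + g y) ler_norml.
  have := ler_wpM2l alpha0 y1; have := le_alpha y; have := le_alpha (- y).
  rewrite !dualN normrN; lra.
have norm_le (h k : dual X) : `|k| - `|h| <= `|h + k|.
  by rewrite [h + k]addrC; exact: lerB_normD.
have fr0 : `|f| * (r - `|x - a|) = 0 by lra.
have gr0 : `|g| * (r - `|x - b|) = 0 by lra.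
have ar_eq : `|x - a| = r.
  move/eqP: fr0; rewrite mulf_eq0 => /orP[/eqP f0|]; last first.
    by rewrite subr_eq0 => /eqP.
  by have := norm_le f g; lra.
have br_eq : `|x - b| = r.
  move/eqP: gr0; rewrite mulf_eq0 => /orP[/eqP g0|]; last first.
    by rewrite subr_eq0 => /eqP.
  by have := norm_le g f; rewrite [g + f]addrC; lra.
split; first by rewrite ar_eq.
(* with z and one of u, v fixed, the minimality is the hypothesis of
   approximate normality for the other one *)
exists f, g; split=> //; [lra|lra|split].
- apply: approximate_normal_near_cone => // u Au; have := key u b x Au Bb.
  rewrite /G !subrr normr0 mulr0 add0r addr0 distrC !dualB.
  move: Fr fle gle.
  by rewrite !dualB; lra.
- apply: approximate_normal_near_cone => // v Bv; have := key a v x Aa Bv.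
  rewrite /G !subrr normr0 mulr0 !add0r distrC !dualB.
  move: Fr fle gle.
  by rewrite !dualB; lra.
Qed.
End Cones.

(** * Metric and dual subtransversality *)

Section Subtransversality.
Context (R : realType) (X : completeNormedModType R).
Implicit Types (A B : set X).

(** A functional within [delta'] of the normal cone at [c] is at most
    [delta' * |w - c|] at [w - c] for every [w] of the set. Applied to both
    functionals at a common point [w] almost nearest to [x], this bounds
    [r = f (x - a) + g (x - b)] by [(f + g) (x - w)] up to a multiple of
    [delta']. *)
Lemma subtransversal_dual A B (xbar : X) (alpha delta alpha' : R) :
    A `&` B !=set0 -> 0 < alpha' -> alpha' < alpha -> alpha < 1 -> 0 < delta ->
    subtransversal_with A B xbar alpha delta ->
  exists2 delta', 0 < delta' & dual_subtransversal_with A B xbar alpha' delta'.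
Proof.
move=> AB0 alpha'0 alpha'1 alpha1 delta0.
have alpha0 := lt_trans alpha'0 alpha'1.
move=> /(subtransversal_withP _ _ AB0 alpha0) st.
pose gap := (alpha - alpha') / 2.
have gap0 : 0 < gap by rewrite /gap; lra.
pose delta' := Num.min delta (gap / 4).
have delta'0 : 0 < delta' by rewrite lt_min delta0; lra.
have [delta'1 delta'2] : delta' <= delta /\ delta' <= gap / 4.
  by rewrite !ge_min !lexx orbT.
exists delta' => // a b x f g [Aa nBa] _ [Bb nAb] _ xd rab fg1 fx gx.
move=> /edist_inf_ltP[n nA fn] /edist_inf_ltP[m mB gm].
rewrite ltNge; apply/negP => fg_le.
set r := `|x - a| in rab fx *; rewrite -rab in gx.
have r0 : 0 < r.
  rewrite lt0r normr_ge0 andbT; apply: contraPneq rab => r0.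
  rewrite -/r r0 => /esym/eqP; rewrite normr_eq0 subr_eq0 => /eqP xb.
  move/eqP: r0; rewrite normr_eq0 subr_eq0 => /eqP xa.
  by apply: nBa; rewrite -xa xb.
have near_cone C (c : X) (h k : dual X) w : normal_cone C c k ->
    `|h - k| < delta' -> C w -> h (w - c) <= delta' * (`|x - w| + `|x - c|).
  move=> kC hk Cw; have := kC _ Cw; have := dual_le_norm (h - k) (w - c).
  rewrite -[(h - k) (w - c)]/(h (w - c) - k (w - c)).
  have : `|h - k| * `|w - c| <= delta' * (`|x - w| + `|x - c|).
    apply: ler_pM => //; first exact: ltW.
    rewrite -(subrKA x w (- c)) (le_trans (ler_normD _ _))//.
    by rewrite lerD2r distrC.
  lra.
(* alpha = alpha' + 2 * gap, and one and a half gaps are spent: half of one on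
   r' being larger than r, a whole one on the functionals being only nearly
   normal *)
pose k := alpha' + gap / 2; pose r' := r * ((alpha' + gap) / k).
have k0 : 0 < k by rewrite /k; lra.
have rr' : r < r' by rewrite /r' ltr_pMr// ltr_pdivlMr// mul1r /k; lra.
have kr' : k * r' = (alpha' + gap) * r by rewrite /r'; field; rewrite gt_eqF.
have [w [Aw Bw] xw] : exists2 w, (A `&` B) w & alpha * `|x - w| < r'.
  by apply: (st x a b) => //; [exact: le_ball xd | rewrite -rab].
have fw := near_cone A a f n w nA fn Aw.
have gw := near_cone B b g m w mB gm Bw.
rewrite -/r in fw; rewrite -rab -/r in gw.
have split_at (h : dual X) c : h (x - c) = h (x - w) + h (w - c).
  by rewrite -dualD subrKA.
have fgxw : f (x - w) + g (x - w) <= alpha' * `|x - w|.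
  by apply: le_trans (dual_le_norm (f + g) (x - w)) _; rewrite ler_wpM2r.
have main : r <= alpha' * `|x - w| + 2 * delta' * (`|x - w| + r).
  have : r = f (x - a) + g (x - b) by rewrite fx gx -mulrDl fg1 mul1r.
  rewrite (split_at f) (split_at g); lra.
have : alpha * r <= k * r' + gap / 2 * r.
  have := ler_wpM2l (ltW alpha0) main.
  have : alpha' * (alpha * `|x - w|) <= alpha' * r' by rewrite ler_wpM2l// ltW.
  have : delta' * (alpha * `|x - w|) <= gap / 4 * r'.
    by apply: ler_pM => //; [exact: ltW|rewrite mulr_ge0// ltW|exact: ltW].
  have : delta' * (alpha * r) <= gap / 4 * r.
    apply: ler_pM => //; [exact: ltW|by rewrite mulr_ge0 ?ltW|].
    by rewrite ler_piMl// ltW.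
  rewrite /k; lra.
rewrite kr' -mulrDl ler_pM2r//; rewrite /gap; lra.
Qed.

(** If the inequality fails at [x0], then some [a0], [b0] are closer to [x0]
    than [r0], where [r0 <= alpha * |x0 - w|] for every common point [w].
    Ekeland's principle starts at [(a0, b0, x0)]; weighing the variable [x] by
    [alpha] is what yields [|f + g| <= alpha] in the end, and weighing the two
    others by [eps < delta] keeps the functionals within [delta] of the normal
    cones. The radius [delta / 3] leaves room for the two displacements, from
    [x0] to [x] and from [x] to [a] or [b], each shorter than [delta / 3]. *)
Lemma dual_subtransversal A B (xbar : X) (alpha delta : R) :
    closed A -> closed B -> convex_set A -> convex_set B -> (A `&` B) xbar ->
    0 < alpha < 1 -> 0 < delta ->
    dual_subtransversal_with A B xbar alpha delta ->
  subtransversal_with A B xbar alpha (delta / 3).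
Proof.
move=> clA clB cvA cvB [Axbar Bxbar] /andP[alpha0 alpha1] delta0 dst.
apply/subtransversal_withP => //; first by exists xbar.
move=> x0 a0 b0 r0 x0d Aa0 Bb0 xa0 xb0.
apply: contrapT => no_w.
have far w : A w -> B w -> r0 <= alpha * `|x0 - w|.
  by move=> Aw Bw; rewrite leNgt; apply/negP => ?; apply: no_w; exists w.
pose eps := delta / 2; have eps0 : 0 < eps by rewrite /eps; lra.
pose S : set (X * X * X) := [set z | A z.1.1 /\ B z.1.2].
pose D (z z' : X * X * X) :=
  alpha * `|z.2 - z'.2| + eps * (`|z.1.1 - z'.1.1| + `|z.1.2 - z'.1.2|).
pose F (z : X * X * X) := Num.max `|z.2 - z.1.1| `|z.2 - z.1.2|.
have D_parts z z' c : D z z' <= c -> [/\ `|z.2 - z'.2| <= c / alpha,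
    `|z.1.1 - z'.1.1| <= c / eps & `|z.1.2 - z'.1.2| <= c / eps].
  move=> Dc; rewrite !ler_pdivlMr//.
  have := mulr_ge0 (ltW alpha0) (normr_ge0 (z.2 - z'.2)).
  have := mulr_ge0 (ltW eps0) (normr_ge0 (z.1.1 - z'.1.1)).
  have := mulr_ge0 (ltW eps0) (normr_ge0 (z.1.2 - z'.1.2)).
  by move: Dc; rewrite /D; split; lra.
have D_tri x y z : D x z <= D x y + D y z.
  rewrite /D.
  have := ler_wpM2l (ltW alpha0) (ler_distD y.2 x.2 z.2).
  have := ler_wpM2l (ltW eps0) (ler_distD y.1.1 x.1.1 z.1.1).
  have := ler_wpM2l (ltW eps0) (ler_distD y.1.2 x.1.2 z.1.2).
  lra.
have D_complete (y : nat -> X * X * X) : (forall n, S (y n)) ->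
    (forall e, 0 < e -> exists N, forall n, (N <= n)%N -> D (y N) (y n) <= e) ->
    exists2 z, S z &
      forall e, 0 < e -> exists N, forall n, (N <= n)%N -> D (y n) z <= e.
  move=> Sy yc.
  have [||u Au yu] := @cauchy_seq_closed_limit _ _ A (fun n => (y n).1.1) clA.
  - by move=> n; case: (Sy n).
  - move=> e e0; have [|N yN] := yc (e * eps); first exact: mulr_gt0.
    by exists N => n /yN/D_parts[_ + _]; rewrite mulfK// gt_eqF.
  have [||v Bv yv] := @cauchy_seq_closed_limit _ _ B (fun n => (y n).1.2) clB.
  - by move=> n; case: (Sy n).
  - move=> e e0; have [|N yN] := yc (e * eps); first exact: mulr_gt0.
    by exists N => n /yN/D_parts[_ _]; rewrite mulfK// gt_eqF.
  have [||x _ yx] :=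
    @cauchy_seq_closed_limit _ _ setT (fun n => (y n).2) closedT.
  - by [].
  - move=> e e0; have [|N yN] := yc (e * alpha); first exact: mulr_gt0.
    by exists N => n /yN/D_parts[+ _ _]; rewrite mulfK// gt_eqF.
  exists ((u, v), x) => // e e0.
  have [|N1 h1] := yu (e / eps / 4); first by rewrite !divr_gt0.
  have [|N2 h2] := yv (e / eps / 4); first by rewrite !divr_gt0.
  have [|N3 h3] := yx (e / alpha / 2); first by rewrite !divr_gt0.
  exists (maxn N1 (maxn N2 N3)) => n; rewrite !geq_max => /and3P[n1 n2 n3].
  have := ler_wpM2l (ltW eps0) (h1 _ n1).
  have := ler_wpM2l (ltW eps0) (h2 _ n2).
  have := ler_wpM2l (ltW alpha0) (h3 _ n3).
  have -> : alpha * (e / alpha / 2) = e / 2 by field; rewrite gt_eqF.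
  have -> : eps * (e / eps / 4) = e / 4 by field; rewrite gt_eqF.
  by rewrite /D/=; lra.
have F_lsc z e : S z -> 0 < e ->
    exists2 h, 0 < h & forall y, S y -> D y z <= h -> F z <= F y + e.
  move=> _ e0; pose h := Num.min (e / 2 * alpha) (e / 2 * eps).
  have h0 : 0 < h by rewrite lt_min !mulr_gt0//; lra.
  exists h => // y _ /D_parts[xy uy vy].
  have scale c : 0 < c -> h <= e / 2 * c -> h / c <= e / 2.
    by move=> c0; rewrite ler_pdivrMr.
  have [/(scale _ alpha0) ha /(scale _ eps0) he] :
    h <= e / 2 * alpha /\ h <= e / 2 * eps by rewrite /h !ge_min !lexx orbT.
  have dist_le (p p' q q' : X) :
      `|p - q| <= `|p' - q'| + (`|p' - p| + `|q' - q|).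
    have := ler_distD p' p q; have := ler_distD q' p' q.
    rewrite (distrC p p'); lra.
  have FyA : `|y.2 - y.1.1| <= F y by rewrite le_max lexx.
  have FyB : `|y.2 - y.1.2| <= F y by rewrite le_max lexx orbT.
  have dA := dist_le z.2 y.2 z.1.1 y.1.1.
  have dB := dist_le z.2 y.2 z.1.2 y.1.2.
  by rewrite [F z]/F ge_max; apply/andP; split; lra.
have F_ge0 z : 0 <= F z by rewrite le_max normr_ge0.
have D_ge0 z z' : 0 <= D z z'.
  by rewrite /D addr_ge0// mulr_ge0 ?addr_ge0// ltW.
have Dzz z : D z z = 0 by rewrite /D !subrr normr0 !mulr0 addr0 mulr0 addr0.
have [[[a b] x] [[/= Aa Bb] Fx xmin]] := @ekeland R _ S D F D_ge0 Dzz D_tri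
  D_complete F_lsc (fun z _ => F_ge0 z) ((a0, b0), x0) (conj Aa0 Bb0).
have {}xmin u v z : A u -> B v -> F ((a, b), x) <=
    Num.max `|z - u| `|z - v| +
    (alpha * `|x - z| + eps * (`|a - u| + `|b - v|)).
  by move=> Au Bv; exact: (xmin ((u, v), z)).
have xa : `|x - a| <= F ((a, b), x) by rewrite le_max lexx.
have xb : `|x - b| <= F ((a, b), x) by rewrite le_max lexx orbT.
have Fx0 : F ((a, b), x) + alpha * `|x0 - x| < r0.
  have : F ((a0, b0), x0) < r0 by rewrite gt_max xa0.
  have : 0 <= eps * (`|a0 - a| + `|b0 - b|) by rewrite mulr_ge0 ?addr_ge0// ltW.
  by move: Fx; rewrite /D/=; lra.
(* a common point as close to x as F would be too close to x0 for r0 *)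
have not_common w : A w -> B w -> `|x - w| <= F ((a, b), x) -> False.
  move=> Aw Bw xw; have := far w Aw Bw.
  have := ler_wpM2l (ltW alpha0) (ler_distD x x0 w).
  have : alpha * `|x - w| <= `|x - w| by rewrite ler_piMl// ltW.
  lra.
have nBa : ~ B a by move=> Ba; exact: (not_common a).
have nAb : ~ A b by move=> Ab; exact: (not_common b).
have Fpos : 0 < F ((a, b), x).
  rewrite lt0r F_ge0 andbT; apply/eqP => F0; apply: nBa.
  move: xa xb; rewrite F0 !normr_le0 !subr_eq0 => /eqP <- /eqP -> //.
have alpha01 : 0 <= alpha < 1 by rewrite ltW.
have [rab [f [g [fg1 fx gx fg_le [[n nA fn] [m mB gm]]]]]] :=
  max_dist_multipliers cvA cvB Aa Bb alpha01 (ltW eps0) Fpos xmin.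
have r0_lt : r0 < alpha * (delta / 3).
  apply: le_lt_trans (far _ Axbar Bxbar) _; rewrite ltr_pM2l//.
  by move: x0d; rewrite -ball_normE /ball_/= distrC.
have r0_lt' : r0 < delta / 3.
  by apply: lt_le_trans r0_lt _; rewrite ler_piMl// ?ltW// divr_gt0.
have x0x : `|x0 - x| < delta / 3.
  by rewrite -(ltr_pM2l alpha0); have := F_ge0 ((a, b), x); lra.
have x0xbar : `|xbar - x0| < delta / 3 by move: x0d; rewrite -ball_normE.
have ax0 := mulr_ge0 (ltW alpha0) (normr_ge0 (x0 - x)).
have xxbar : `|xbar - x| < delta / 3 + delta / 3.
  by have := ler_distD x0 xbar x; lra.
have eps_delta : eps < delta by rewrite /eps; lra.
have : alpha < `|f + g|.
  apply: (dst a b x) => //.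
  - by rewrite -ball_normE /ball_/=; have := ler_distD x xbar a; lra.
  - by rewrite -ball_normE /ball_/=; have := ler_distD x xbar b; lra.
  - by rewrite -ball_normE /ball_/=; lra.
  - by apply/edist_inf_ltP; exists n => //; exact: le_lt_trans eps_delta.
  - by apply/edist_inf_ltP; exists m => //; exact: le_lt_trans eps_delta.
by rewrite ltNge fg_le.
Qed.
End Subtransversality.

(** * The characterization and the equality of the constants *)

Theorem theorem3 (R : realType) (X : completeNormedModType R)
    (A B : set X) (xbar : X)
    (clA : closed A) (clB : closed B)
    (cvxA : convex_set A) (cvxB : convex_set B)
    (xbarAB : (A `&` B) xbar) :
  (subtransversal A B xbar <->
     exists alpha delta : R, [/\ 0 < alpha < 1, 0 < delta &
       dual_subtransversal_with A B xbar alpha delta]) /\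
  sup [set alpha : R | 0 < alpha < 1 /\
    exists2 delta : R, 0 < delta & dual_subtransversal_with A B xbar alpha delta]
  = str A B xbar.
Proof.
have AB0 : A `&` B !=set0 by exists xbar.
rewrite /str; set dualS := [set _ | _]; set primalS := [set _ | _].
have dual_primal : dualS `<=` primalS.
  move=> alpha [alpha01 [delta delta0 dst]]; split=> //.
  by exists (delta / 3); [rewrite divr_gt0|exact: dual_subtransversal dst].
have primal_dual alpha alpha' :
    primalS alpha -> 0 < alpha' -> alpha' < alpha -> dualS alpha'.
  move=> [/andP[_ alpha1] [delta delta0 st]] alpha'0 lt_alpha; split.
    by rewrite alpha'0 (lt_trans lt_alpha).
  exact: (subtransversal_dual AB0 alpha'0 lt_alpha alpha1 delta0 st).
have half alpha : primalS alpha -> dualS (alpha / 2).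
  move=> pa; have [/andP[alpha0 _] _] := pa.
  by apply: (primal_dual alpha) => //; lra.
split.
  split=> -[alpha [delta [alpha01 delta0 st]]].
    have [|h01 [delta' delta'0 dst]] := half alpha.
      by split=> //; exists delta.
    by exists (alpha / 2), delta'.
  have [|_ [delta' delta'0 st']] := dual_primal alpha.
    by split=> //; exists delta.
  by exists alpha, delta'.
have [[alpha0 pa]|noP] := pselect (primalS !=set0); last first.
  congr sup; rewrite eqEsubset; split=> // alpha pa.
  by case: noP; exists alpha.
have primal_ub : has_ubound primalS by exists 1 => a [/andP[_ /ltW]].
have dual_ub : has_ubound dualS by exists 1 => a [/andP[_ /ltW]].
have da := half _ pa.
apply/le_anti/andP; split.
  apply: ge_sup; first by exists (alpha0 / 2).
  by move=> a /dual_primal pa'; exact: ub_le_sup.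
apply: ge_sup; first by exists alpha0.
move=> a pa'; have [/andP[a0 a1] _] := pa'.
apply/ler_addgt0Pr => e e0.
have [ea|ae] := ltP e a; last first.
  (* sup dualS is positive, hence above a - e *)
  have := ub_le_sup dual_ub (half _ pa'); lra.
have d_ae : dualS (a - e) by apply: (primal_dual a) => //; lra.
have := ub_le_sup dual_ub d_ae; lra.
Qed.
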